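(* Let $k \geq 2$ be an integer and let $D$ be a digraph of order $n \geq 3k$. If $\delta^{0}(D) \geq \lceil (n+k)/2 \rceil$, then $D$ is one-to-many $k$-coverable. Moreover, the bound for $\delta^{0}(D)$ is sharp when $n+k$ is even and is sharp up to an additive constant $1$ otherwise, in the following sense: for every $k\geq 2$ and every $n\geq 3k$, if $n+k$ is even there exists a digraph $D$ on $n$ vertices with $\delta^{0}(D)=\lceil (n+k)/2\rceil-1$ which is not one-to-many $k$-coverable, and if $n+k$ is odd there exists a digraph $D$ on $n$ vertices with $\delta^{0}(D)=\lceil (n+k)/2\rceil-2$ which is not one-to-many $k$-coverable.
   Context: All digraphs $D=(V(D),A(D))$ are finite, with no parallel arcs and no loops (pairs of oppositely directed arcs are allowed). The order of $D$ is $|V(D)|$. A path always means a directed path; an $x$-$y$ path is a path from $x$ to $y$. The minimum semi-degree $\delta^{0}(D)$ is the minimum, over all vertices $v$ of $D$, of the out-degrees $d^{+}_D(v)$ and in-degrees $d^{-}_D(v)$. Let $S=\{s\}$ (source set) and $T=\{t_1,\dots,t_k\}$ (sink set, with $k$ distinct elements) be disjoint subsets of $V(D)$. A one-to-many $k$-DDPC ($k$-disjoint directed path cover) for $S$ and $T$ is a set of $k$ paths $\{P_1,\dots,P_k\}$ of $D$ such that $\bigcup_{i=1}^{k}V(P_i)=V(D)$, each $P_i$ is an $s$-$t_i$ path, and $V(P_i)\cap V(P_j)=\{s\}$ for $i\neq j$. A digraph $D$ of order $n\geq k+1$ is one-to-many $k$-coverable if it has a one-to-many $k$-DDPC for every pair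 of disjoint source set $S=\{s\}$ and sink set $T=\{t_1,\dots,t_k\}$. *)

(* Defs.v *)
From mathcomp Require Import all_boot.

Set Implicit Arguments.
Unset Strict Implicit.
Unset Printing Implicit Defensive.

(* [darc] being a relation excludes parallel arcs; opposite arcs are allowed. *)
Record digraph := Digraph {
  vertex :> finType;
  darc : rel vertex;
  darc_irr : irreflexive darc
}.

Definition digraph_order (D : digraph) : nat := #|D|.

Definition outdeg (D : digraph) (v : D) : nat := #|[set w | darc v w]|.

Definition indeg (D : digraph) (v : D) : nat := #|[set w | darc w v]|.

(* Every degree is smaller than [digraph_order D], so for a nonempty [D] the default
   value [digraph_order D] does not affect the minimum. *)
Definition min_semidegree (D : digraph) : nat :=
  \big[minn/digraph_order D]_(v : D) minn (outdeg v) (indeg v).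

(* A path is given by the sequence of all its vertices, endpoints included. *)
Definition is_dipath (D : digraph) (x y : D) (p : seq D) : Prop :=
  exists q : seq D,
    [/\ p = x :: q, path (@darc D) x q, last x q = y & uniq p].

Definition one_to_many_ddpc (D : digraph) (k : nat)
    (s : D) (t : 'I_k -> D) (P : 'I_k -> seq D) : Prop :=
  [/\ \bigcup_(i < k) [set v in P i] = [set: D],
      forall i, is_dipath s (t i) (P i)
    & forall i j, i != j -> [set v in P i] :&: [set v in P j] = [set s]].

(* The sink set is given by an injective enumeration t_1, ..., t_k. *)
Definition one_to_many_coverable (k : nat) (D : digraph) : Prop :=
  k + 1 <= digraph_order D /\
  forall (s : D) (t : 'I_k -> D),
    injective t -> (forall i, t i != s) ->
    exists P : 'I_k -> seq D, one_to_many_ddpc s t P.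

(* Main.v *)
Require Import Defs.
From mathcomp Require Import all_boot.
From mathcomp Require Import zify.

Set Implicit Arguments.
Unset Strict Implicit.
Unset Printing Implicit Defensive.

(** The problem is a Hamiltonian cycle problem in disguise. Delete [s] and let
    every sink [t i] inherit the out-arcs of [s] in place of its own. A
    Hamiltonian cycle of this rerouted digraph on [n - 1] vertices is cut by the
    sinks into [k] pieces; each piece ends at a sink and, since its first vertex
    is entered from a sink, starts at an out-neighbour of [s]. Putting [s] in
    front of the pieces gives the required cover ([cut_at_sinks]).

    With [h] the minimum semidegree, a rerouted out-neighbourhood misses at most
    one vertex, so out-degrees are at least [h - 1]. An out-neighbour of [s]
    keeps all its in-arcs but the one from [s], and any other vertex loses at
    most the [k] arcs from the sinks, so in-degrees are at least [h - k].
    As [2h >= n + k], these two bounds add up to at least [n - 1], the order of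
    the rerouted digraph.

    It remains to see that a digraph of order [N], out-degrees at least [a],
    in-degrees at least [b] and [N <= a + b] is Hamiltonian
    ([hamiltonian_cycle]). Take a longest cycle, of size [m < N], and a longest
    path outside it, with [l] vertices, from [x] to [y]. At least [b - (l - 1)]
    vertices [u] of the cycle have an arc to [x], at least [a - (l - 1)] vertices
    [v] receive an arc from [y], and both numbers are positive because
    [m > a, b]. The path can replace the stretch of the cycle strictly between
    such a [u] and such a [v], so by maximality this stretch has at least [l]
    vertices. Hence the vertex after each [u], and the [l] vertices after the
    last [u] preceding some [v], are never a [v]; counting gives
    [a + b - 2(l - 1) <= m + 1 - l], that is [a + b < m + l <= N].

    For sharpness, glue two complete digraphs along [k] common vertices, take
    these as sinks and [s] on one side: a path leaving [s] for the other side
    has to pass through a sink, where it must end. *)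

(** * Splitting sequences *)

Lemma split_first (T : Type) (a : pred T) (s : seq T) :
  has a s -> exists s1 x s2, [/\ s = s1 ++ x :: s2, a x & ~~ has a s1].
Proof.
case/split_find => x s1 s2 ax hs1.
by exists s1, x, s2; rewrite cat_rcons.
Qed.

Lemma split_last (T : Type) (a : pred T) (s : seq T) :
  has a s -> exists s1 x s2, [/\ s = s1 ++ x :: s2, a x & ~~ has a s2].
Proof.
rewrite -has_rev => /split_first [s1 [x [s2 [sE ax hs1]]]].
exists (rev s2), x, (rev s1); split; rewrite ?has_rev //.
by rewrite -(revK s) sE rev_cat rev_cons cat_rcons.
Qed.

Lemma path_adjacent (T : Type) (R : rel T) (w : T) (d : seq T) :
  (forall d1 u v d2, w :: d = d1 ++ u :: v :: d2 -> R u v) -> path R w d.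
Proof.
elim: d w => //= v d IH w adj; apply/andP; split; first exact: (adj [::] w v d).
by apply: IH => d1 u u' d2 dE; apply: (adj (w :: d1) u u' d2); rewrite dE.
Qed.

(** * Longest cycles and Hamiltonicity *)

Section HamiltonianCycle.

Variables (V : finType) (e : rel V).

Lemma exists_longest_uniq (P : pred (seq V)) (s0 : seq V) :
  P s0 -> uniq s0 ->
  exists s, [/\ P s, uniq s &
    forall s', P s' -> uniq s' -> size s' <= size s].
Proof.
move=> Ps0 us0.
pose Q n := [exists r : n.-tuple V, P r && uniq r].
have exQ : exists n, Q n.
  by exists (size s0); apply/existsP; exists (in_tuple s0); rewrite Ps0 us0.
have boundQ n : Q n -> n <= #|V|.
  case/existsP=> r /andP[_ /card_uniqP ur].
  by rewrite -(size_tuple r) -ur max_card.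
case: (ex_maxnP exQ boundQ) => m /existsP[r /andP[Pr ur]] maxm.
exists r; split=> // s' Ps' us'; rewrite size_tuple; apply: maxm.
by apply/existsP; exists (in_tuple s'); rewrite Ps' us'.
Qed.

(** All out-neighbours of the last vertex of a longest path lie on that path;
    closing the path at the earliest of them gives a cycle through that last
    vertex and all its out-neighbours. *)
Lemma long_cycle (a : nat) (x0 : V) :
  irreflexive e -> (forall x, a <= #|[set y | e x y]|) -> 0 < a ->
  exists c, [/\ cycle e c, uniq c & a < size c].
Proof.
move=> irr dega a_gt0.
have [s [Ps us maxs]] := @exists_longest_uniq (fun s => (s != [::]) && sorted e s)
  [:: x0] isT isT.
case: s Ps us maxs => //= x q pq uxq maxs.
pose y := last x q.
have out_in z : e y z -> z \in x :: q.
  move=> eyz; apply/negPn/negP => zp.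
  have up : uniq (x :: rcons q z).
    by rewrite -rcons_cons rcons_uniq zp.
  have pp : path e x (rcons q z) by rewrite rcons_path pq.
  by have := maxs (x :: rcons q z) pp up; rewrite /= size_rcons ltnn.
have hasp : has (e y) (x :: q).
  have /card_gt0P [z] := leq_trans a_gt0 (dega y).
  rewrite inE => eyz; apply/hasP; exists z => //; exact: out_in.
have [s1 [z [s2 [pE eyz ns1]]]] := split_first hasp.
have lastE : last z s2 = y by rewrite /y -[last x q]/(last x (x :: q)) pE last_cat.
exists (z :: s2); split.
- rewrite /= rcons_path lastE eyz andbT.
  have : sorted e (s1 ++ z :: s2) by rewrite -pE.
  by case: (s1) => //= ? ?; rewrite cat_path /= => /and3P[].
- by move: uxq; rewrite -[_ && _]/(uniq (x :: q)) pE cat_uniq => /and3P[].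
- have sub : [set w | e y w] \subset [set w in z :: s2] :\ y.
    apply/subsetP=> w; rewrite !inE => eyw; apply/andP; split.
      by apply: contraTneq eyw => ->; rewrite irr.
    have := out_in w eyw; rewrite pE mem_cat => /orP[ws1|].
      by move: (hasPn ns1 w ws1); rewrite /= eyw.
    by rewrite inE.
  have yin : y \in [set w in z :: s2] by rewrite inE -lastE mem_last.
  have := subset_leq_card sub; have := cardsD1 y [set w in z :: s2].
  rewrite yin; have := dega y.
  have : #|[set w in z :: s2]| <= size (z :: s2).
    by rewrite cardsE card_size.
  lia.
Qed.

(** Distinct members of [A] have distinct successors, none of which is in [B]. *)
Lemma count_no_consecutive (A B : pred V) w s :
  path (fun u v => ~~ (A u && B v)) w s ->
  count A (belast w s) + count B s <= size s.
Proof.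
elim: s w => //= v s IH w /andP[nAB /IH].
by move: nAB; case: (A w); case: (B v) => //=; lia.
Qed.

(** Substituting the path [x :: q] for the stretch [d2] of a cycle gives a cycle,
    so when that cycle has the largest size, [d2] is at least as long as the
    path. *)
Lemma cycle_absorbs (c : seq V) (v : V) (d d2 : seq V) (x : V) (q : seq V) :
  (forall c', cycle e c' -> uniq c' -> size c' <= size c) ->
  cycle e (v :: d ++ d2) -> uniq (v :: d ++ d2) ->
  path e x q -> uniq (x :: q) -> ~~ has (mem (v :: d ++ d2)) (x :: q) ->
  e (last v d) x -> e (last x q) v ->
  size (v :: d) + size (x :: q) <= size c.
Proof.
move=> maxc cyc uc pq uq dis eux eyv.
have := maxc (v :: d ++ x :: q); rewrite -cat_cons size_cat; apply.
  move: cyc; rewrite /= !rcons_cat /= !cat_path /= => /andP[-> _] /=.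
  by rewrite eux rcons_path pq.
move: uc; rewrite -!cat_cons !cat_uniq => /and3P[-> _ _].
rewrite uq andbT andTb.
apply: contra dis => /hasP[z zq zd]; apply/hasP; exists z => //=.
by rewrite -cat_cons mem_cat; move: zd => /= ->.
Qed.

End HamiltonianCycle.

(** A weak form of the theorems of Ghouila-Houri and Woodall, in which the bounds
    on out- and in-degrees may differ as long as their sum is large. *)
Lemma hamiltonian_cycle (V : finType) (e : rel V) (a b : nat) :
  irreflexive e ->
  (forall x, a <= #|[set y | e x y]|) -> (forall x, b <= #|[set y | e y x]|) ->
  #|V| <= a + b ->
  exists c, [/\ cycle e c, uniq c & size c = #|V|].
Proof.
move=> irr dega degb leVab.
case: (posnP #|V|) => [V0|]; first by exists [::].
case/card_gt0P => x0 _.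
have lt_card (R : rel V) : irreflexive R -> #|[set y | R x0 y]| < #|V|.
  move=> irrR; apply: proper_card; apply/properP; split; first exact/subsetP.
  by exists x0; rewrite // inE irrR.
have lta := leq_ltn_trans (dega x0) (lt_card e irr).
have ltb := leq_ltn_trans (degb x0) (lt_card (fun x y => e y x) irr).
have [c [cycc uc maxc]] := @exists_longest_uniq V (cycle e) [::] isT isT.
have lt_ac : a < size c.
  have [|c' [cyc' uc' lt_c']] := long_cycle x0 irr dega; first lia.
  exact: leq_trans lt_c' (maxc _ cyc' uc').
have lt_bc : b < size c.
  (* In-degrees are out-degrees of the reversed digraph. *)
  have [|c' [cyc' uc' lt_c']] := @long_cycle V (fun x y => e y x) b x0 irr degb; first lia.
  by rewrite -(size_rev c') in lt_c'; apply: leq_trans lt_c' (maxc _ _ _);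
    rewrite ?rev_cycle ?rev_uniq.
have le_cV : size c <= #|V| by rewrite -(card_uniqP uc) max_card.
exists c; split=> //; apply/eqP; rewrite eqn_leq le_cV leqNgt; apply/negP => lt_cV.
have [z0 z0c] : exists z, z \notin c.
  apply/existsP; rewrite -negb_forall; apply/negP => /forallP inc.
  move: lt_cV; rewrite ltnNge -(card_uniqP uc) => /negP; apply.
  by apply/subset_leq_card/subsetP => z _; apply: inc.
have [|s [/and3P[]]] := @exists_longest_uniq V
  (fun s => [&& s != [::], sorted e s & ~~ has (mem c) s]) [:: z0] _ isT.
  by rewrite /= orbF z0c.
case: s => // x q _ pq dis up maxp; pose y := last x q.
have le_pc : (size q).+1 + size c <= a + b.
  apply: leq_trans leVab; rewrite -[(size q).+1]/(size (x :: q)) -size_cat.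
  rewrite -(card_uniqP (_ : uniq ((x :: q) ++ c))) ?max_card //.
  rewrite cat_uniq up uc andbT; apply: contra dis => /hasP[z zc zp].
  by apply/hasP; exists z.
(* A neighbour elsewhere would extend the path. *)
have out_c z : e y z -> (z \in c) || (z \in x :: q).
  move=> eyz; apply/negPn; rewrite negb_or; apply/negP => /andP[zc zp].
  have := maxp (x :: rcons q z); rewrite /= size_rcons ltnn => absurd.
  suff: false by []; apply: absurd.
    rewrite rcons_path [path e x q]pq eyz has_rcons /=.
    by move: dis zc => /= /norP[/negPf -> /negPf ->] /negPf ->.
  by rewrite -[_ && _]/(uniq (x :: rcons q z)) -rcons_cons rcons_uniq zp.
have in_c z : e z x -> (z \in c) || (z \in x :: q).
  move=> ezx; apply/negPn; rewrite negb_or; apply/negP => /andP[zc zp].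
  have := maxp (z :: x :: q); rewrite /= ltnn => absurd.
  suff: false by []; apply: absurd.
    by move: pq dis zc => /= -> /negPf -> /negPf ->; rewrite ezx.
  by move: up zp => /= -> ->.
have count_deg (R : pred V) n w : n <= #|[set z | R z]| ->
    (forall z, R z -> (z \in c) || (z \in x :: q)) -> w \in x :: q -> ~~ R w ->
    n <= count R c + size q.
  move=> le_n subR wp nRw.
  have sub : [set z | R z] \subset
      [set z in filter R c] :|: ([set z in x :: q] :\ w).
    apply/subsetP => z; rewrite !inE mem_filter => Rz; have := subR z Rz.
    rewrite inE Rz /= => /orP[->//|->]; rewrite andbT orbC.
    by case: eqP => // zw; rewrite -zw Rz in nRw.
  have h1 := leq_trans (subset_leq_card sub) (leq_card_setU _ _).
  have h2 : #|[set z in filter R c]| <= count R c.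
    by rewrite cardsE -size_filter card_size.
  have h3 := cardsD1 w [set z in x :: q]; rewrite inE wp in h3.
  have h4 : #|[set z in x :: q]| <= (size q).+1 by rewrite cardsE (card_size (x :: q)).
  lia.
have le_B : a <= count (e y) c + size q :=
  count_deg (e y) a y (dega y) out_c (mem_last x q) (negbT (irr y)).
have le_A : b <= count (e^~ x) c + size q :=
  count_deg (e^~ x) b x (degb x) in_c (mem_head x q) (negbT (irr x)).
have hasB : has (e y) c by rewrite has_count; lia.
have hasA : has (e^~ x) c by rewrite has_count; lia.
(* Rotate the cycle to start at an out-neighbour [w] of [y], then cut it after
   the last in-neighbour [z] of [x]: it reads [w :: d] ending at [z], then [c2]. *)
have [s1 [w [s2 [cE eyw _]]]] := split_first hasB.
pose r := s2 ++ s1.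
have rotE : w :: r = rot (size s1) c by rewrite cE rot_size_cat.
have cycr : cycle e (w :: r) by rewrite rotE rot_cycle.
have ur : uniq (w :: r) by rewrite rotE rot_uniq.
have permr : perm_eq (w :: r) c by rewrite rotE perm_rot.
have sizer := perm_size permr.
have disr : ~~ has (mem (w :: r)) (x :: q).
  apply: contra dis => /hasP[z zp zr]; apply/hasP; exists z => //.
  by rewrite /= -(perm_mem permr).
have absorb v d d2 i : v :: d ++ d2 = rot i (w :: r) ->
    e (last v d) x -> e y v -> size (v :: d) + size (x :: q) <= size c.
  move=> rE eux eyv; apply: (cycle_absorbs (d2 := d2) maxc) eux eyv => //; rewrite rE.
  - by rewrite rot_cycle.
  - by rewrite rot_uniq.
  - apply: contra disr => /hasP[z zp zr]; apply/hasP; exists z => //.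
    by move: zr; rewrite /= mem_rot.
have [c1 [z [c2 [rE ezx nAc2]]]] : exists c1 z c2,
    [/\ w :: r = c1 ++ z :: c2, e z x & ~~ has (e^~ x) c2].
  by apply: (split_last (a := e^~ x)); rewrite rotE has_rot.
have [d [dE lastd rE']] : exists d, [/\ w :: d = rcons c1 z, last w d = z & r = d ++ c2].
  case: c1 rE => [|w' c1] /= [-> ->].
    by exists [::].
  by exists (rcons c1 z); rewrite last_rcons cat_rcons.
subst r; rewrite rE' in rotE cycr ur permr sizer disr absorb rE *.
(* The stretch [c2] lies between [z] and, cyclically, [w]. *)
have le_c2 : size q < size c2.
  have := absorb w d c2 0; rewrite rot0 lastd => /(_ erefl ezx eyw).
  by move: sizer; rewrite /= size_cat; clear; lia.
(* An early out-neighbour of [y] in [c2] would end too short a stretch after [z]. *)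
have nBc2 : ~~ has (e y) (take (size q).+1 c2).
  apply/negP => /split_first[f1 [v [f2 [fE eyv _]]]].
  have c2E : c2 = f1 ++ v :: f2 ++ drop (size q).+1 c2.
    by rewrite -{1}(cat_take_drop (size q).+1 c2) fE -catA.
  move: (f2 ++ drop _ _) c2E => g c2E.
  have := absorb v (g ++ w :: d) f1 (size (w :: d ++ f1)).
  rewrite c2E catA -cat_cons rot_size_cat last_cat /= lastd -catA => /(_ erefl ezx eyv).
  have := congr1 size fE; rewrite size_takel // size_cat /=.
  by move: sizer; rewrite c2E /= !size_cat /= ?size_cat /=; clear; lia.
(* Here the stretch to be replaced would be empty. *)
have adj : path (fun u v => ~~ (e u x && e y v)) w d.
  apply: path_adjacent => d1 u v d2 dE'; apply/negP => /andP[eux eyv].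
  have splitE : w :: d ++ c2 = rcons d1 u ++ v :: d2 ++ c2.
    by rewrite -cat_cons dE' cat_rcons -catA.
  have := absorb v (d2 ++ c2 ++ rcons d1 u) [::] (size (rcons d1 u)).
  rewrite cats0 splitE rot_size_cat !last_cat last_rcons /= -catA.
  move=> /(_ erefl eux eyv).
  have := congr1 size dE'; move: sizer; rewrite /= !size_cat size_rcons /=; clear; lia.
have cnt := count_no_consecutive adj.
have cntA : count (e^~ x) c = (count (e^~ x) (belast w d)).+1.
  rewrite -(permP permr) -cat_cons count_cat lastI lastd -cats1 count_cat /= ezx.
  by move: nAc2; rewrite has_count; clear; lia.
have cntB : count (e y) c <= (count (e y) d).+1 + (size c2 - (size q).+1).
  rewrite -(permP permr) /= eyw count_cat -{1}(cat_take_drop (size q).+1 c2) count_cat.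
  move: nBc2; rewrite has_count -leqNgt leqn0 => /eqP ->.
  have := count_size (e y) (drop (size q).+1 c2); rewrite size_drop; clear; lia.
move: sizer le_c2 cnt le_A le_B le_pc lt_cV leVab; rewrite cntA /= size_cat.
move: cntB; clear; lia.
Qed.

(** * Rerouting the sinks through the source *)

Section Rerouting.

Variables (V : eqType) (e : rel V) (s : V) (T : pred V).

Definition reroute (v : V) : V := if T v then s else v.

Lemma path_reroute_off (y : V) (b : seq V) (t : V) :
  ~~ has T b ->
  path (fun u v => e (reroute u) v) y (rcons b t) = path e (reroute y) (rcons b t).
Proof.
elim: b y => //= x b IH y /norP[nTx nTb].
by rewrite IH // {2}/reroute (negPf nTx).
Qed.

(** The piece [f t] runs from just after the previous sink up to [t]. As all sinks
    have been given the out-arcs of [s], it does not matter which sink precedes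
    it: the piece can always be attached to [s]. *)
Lemma cut_at_sinks (y : V) (c : seq V) :
  path (fun u v => e (reroute u) v) y c -> T y -> T (last y c) -> uniq c ->
  exists f : V -> seq V,
    [/\ forall t, T t -> t \in c ->
          [/\ path e s (f t), last s (f t) = t, uniq (f t) & {subset f t <= c}],
        forall v, v \in c -> exists t, [/\ T t, t \in c & v \in f t]
      & forall t t' v, T t -> t \in c -> T t' -> t' \in c ->
          v \in f t -> v \in f t' -> t = t'].
Proof.
have [n] := ubnP (size c); elim: n y c => // n IH y c lt_cn.
case: (posnP (size c)) => [/size0nil -> _ _ _ _|c_gt0 pc Ty Tl uc].
  by exists (fun=> [::]); split.
have hasT : has T c.
  by apply/hasP; exists (last y c) => //; case: (c) c_gt0 => //= *; apply: mem_last.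
have [c1 [t [c2 [cE Tt nT1]]]] := split_first hasT.
move: pc uc; rewrite cE -cat_rcons cat_path last_rcons cat_uniq.
rewrite path_reroute_off // {1}/reroute Ty => /andP[p1 p2] /and3P[u1 dis u2].
have [||f [fpath fcov fdis]] := IH t c2 _ p2 Tt _ u2.
- by move: lt_cn; rewrite cE size_cat /=; lia.
- by move: Tl; rewrite cE last_cat.
have t1 : t \in rcons c1 t by rewrite mem_rcons mem_head.
have dis12 v : v \in rcons c1 t -> v \in c2 -> False.
  by move=> v1 v2; case/hasP: dis; exists v.
have sink1 t' : T t' -> t' \in rcons c1 t -> t' = t.
  move=> Tt'; rewrite mem_rcons inE => /predU1P[//|t'1].
  by have := hasPn nT1 t' t'1; rewrite /= Tt'.
have sink2 t' : T t' -> t' \in rcons c1 t ++ c2 -> t' <> t -> t' \in c2.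
  by move=> Tt'; rewrite mem_cat => /orP[/(sink1 _ Tt')|].
exists (fun t' => if t' == t then rcons c1 t else f t'); split.
- move=> t' Tt' t'c; case: eqP => [->|/(sink2 _ Tt' t'c) t'2].
    by split; rewrite ?last_rcons // => v v1; rewrite mem_cat v1.
  have [? ? ? sub] := fpath t' Tt' t'2; split=> // v /sub v2.
  by rewrite mem_cat v2 orbT.
- move=> v; rewrite mem_cat => /orP[v1|/fcov[t' [Tt' t'2 vt']]].
    by exists t; rewrite eqxx mem_cat t1.
  exists t'; rewrite mem_cat t'2 orbT; case: eqP => // t'E.
  by case: (dis12 t') => //; rewrite t'E.
- move=> t' t'' v Tt' t'c Tt'' t''c.
  case: eqP => [->|/(sink2 _ Tt' t'c) t'2]; case: eqP => [->|/(sink2 _ Tt'' t''c) t''2] //.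
  + by move=> v1 /(let: And4 _ _ _ sub := fpath _ Tt'' t''2 in sub v) /(dis12 _ v1).
  + by move=> /(let: And4 _ _ _ sub := fpath _ Tt' t'2 in sub v) v2 /dis12 /(_ v2).
  + exact: fdis.
Qed.

End Rerouting.

(** * Semidegree and coverability *)

Lemma min_semidegree_le (D : digraph) (v : D) :
  min_semidegree D <= outdeg v /\ min_semidegree D <= indeg v.
Proof.
suff : min_semidegree D <= minn (outdeg v) (indeg v) by rewrite leq_min => /andP.
rewrite /min_semidegree; move: (mem_index_enum v).
elim: (index_enum _) => // u r IH; rewrite inE big_cons.
case/predU1P => [<-|/IH vr]; first exact: geq_minl.
exact: leq_trans (geq_minr _ _) vr.
Qed.

(** The degree bounds of the rerouted digraph meet the hypothesis of
    [hamiltonian_cycle]: [(h - 1) + (h - k) >= n - 1], with equality when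
    [2h = n + k]. *)
Lemma coverable_of_semidegree (D : digraph) (k : nat) :
  0 < k -> k + 1 <= digraph_order D ->
  digraph_order D + k <= (min_semidegree D).*2 -> one_to_many_coverable k D.
Proof.
set h := min_semidegree D; set n := digraph_order D.
move=> k_gt0 le_kn le_nh; split=> // s t inj_t t_s.
have outD (v : D) : h <= #|[set w | darc v w]| by have [] := min_semidegree_le v.
have inD (v : D) : h <= #|[set w | darc w v]| by have [] := min_semidegree_le v.
pose T : pred D := fun v => v \in codom t.
have cardT : #|[set v | T v]| = k by rewrite cardsE card_codom ?card_ord.
pose V := {v : D | v != s}.
pose e : rel V := fun u v => (u != v) && darc (reroute s T (val u)) (val v).
have cardV : #|{: V}| = n.-1 by rewrite card_sig cardC1.
have irr_e : irreflexive e by move=> u; rewrite /e eqxx.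
have image_card (X Y : {set D}) (S : {set V}) :
    X \subset [set val v | v in S] :|: Y -> #|X| <= #|S| + #|Y|.
  move=> /subset_leq_card /leq_trans; apply.
  by rewrite -(card_imset _ val_inj) leq_card_setU.
have out_e u : h.-1 <= #|[set v | e u v]|.
  (* The removed loop costs an out-neighbour to a sink that [s] points to; any
     other vertex can only lose the deleted vertex [s]. *)
  pose lost := if T (val u) then val u else s.
  have sub : [set w | darc (reroute s T (val u)) w]
      \subset [set val v | v in [set v | e u v]] :|: [set lost].
    apply/subsetP => w; rewrite !inE => arc; rewrite orbC.
    have [//|w_lost] := eqVneq w lost.
    have w_s : w != s.
      move: arc w_lost; rewrite /lost /reroute; case: (T (val u)) => // arc _.
      by apply: contraTneq arc => ->; rewrite darc_irr.
    apply/imsetP; exists (Sub w w_s) => //; rewrite inE /e arc andbT -val_eqE /=.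
    apply: contraNneq w_lost => uw; move: arc; rewrite /lost /reroute.
    by case: (T (val u)); rewrite -uw ?eqxx ?darc_irr.
  rewrite -subn1 leq_subLR addnC -(cards1 lost).
  exact: leq_trans (outD _) (image_card _ _ _ sub).
have in_e v : h - k <= #|[set u | e u v]|.
  (* If [s] points to [v], all other sinks now do, so only [s] itself is lost. *)
  have [sv|nsv] := boolP (darc s (val v)).
    have sub : [set w | darc w (val v)]
        \subset [set val u | u in [set u | e u v]] :|: [set s].
      apply/subsetP => w; rewrite !inE => arc; rewrite orbC.
      have [//|w_s] := eqVneq w s; apply/imsetP; exists (Sub w w_s) => //.
      rewrite inE /e -val_eqE /= /reroute; case: (T w); rewrite ?sv ?arc andbT;
        by apply: contraTneq arc => ->; rewrite darc_irr.
    rewrite (leq_trans (leq_sub2l h k_gt0)) // leq_subLR addnC -(cards1 s).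
    exact: leq_trans (inD _) (image_card _ _ _ sub).
  have sub : [set w | darc w (val v)]
      \subset [set val u | u in [set u | e u v]] :|: [set w | T w].
    apply/subsetP => w; rewrite !inE => arc; rewrite orbC.
    have [//|nTw] := boolP (T w).
    have w_s : w != s by apply/eqP => ws; move: nsv; rewrite -{1}ws arc.
    apply/imsetP; exists (Sub w w_s) => //.
    rewrite inE /e -val_eqE /= /reroute (negPf nTw) arc andbT.
    by apply: contraTneq arc => ->; rewrite darc_irr.
  rewrite leq_subLR addnC -cardT.
  exact: leq_trans (inD _) (image_card _ _ _ sub).
have [|c [cycc uc sizec]] := hamiltonian_cycle irr_e out_e in_e.
  rewrite cardV; lia.
have inc v : v \in c.
  suff -> : c =i {: V} by rewrite inE.
  by apply/subset_cardP; [rewrite (card_uniqP uc) | exact/subsetP].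
(* Starting the cycle just after a sink makes the listing end at that sink. *)
pose i0 := Ordinal k_gt0; pose u0 : V := Sub (t i0) (t_s i0).
have [j q rotE] := rot_to (inc u0).
have Tt i : T (t i) by apply: codom_f.
pose c' := map val (rcons q u0).
have inc' v : (v \in c') = (v != s).
  apply/mapP/idP => [[u _ ->]|v_s]; first exact: (svalP u).
  exists (Sub v v_s) => //; rewrite mem_rcons -rotE mem_rot; exact: inc.
have [|||| f [fpath fcov fdis]] := @cut_at_sinks D (@darc D) s T (t i0) c'.
- have : cycle e (u0 :: q) by rewrite -rotE rot_cycle.
  rewrite /c' -[t i0]/(val u0) path_map /=; apply: sub_path => u v.
  by case/andP.
- exact: Tt.
- by rewrite /c' map_rcons last_rcons; apply: Tt.
- by rewrite map_inj_uniq ?rcons_uniq; [rewrite -cons_uniq -rotE rot_uniq | exact: val_inj].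
have tc i : t i \in c' by rewrite inc'.
exists (fun i => s :: f (t i)); split.
- apply/setP => v; rewrite inE; apply/bigcupP.
  have [->|v_s] := eqVneq v s; first by exists i0 => //; rewrite inE mem_head.
  have [|t' [/codomP[i ->] _ vf]] := fcov v; first by rewrite inc'.
  by exists i => //; rewrite !inE vf orbT.
- move=> i; have [pf lf uf sub] := fpath _ (Tt i) (tc i).
  exists (f (t i)); split=> //=; rewrite uf andbT.
  by apply/negP => /sub; rewrite inc' eqxx.
- move=> i i' ii'; apply/setP => v; rewrite !inE.
  have [//|v_s] := eqVneq v s; apply/negP => /= /andP[vi vi'].
  by move/eqP: ii'; apply; apply: inj_t; apply: fdis vi vi'.
Qed.

(** * Two cliques glued along the sinks *)

Section TwoCliques.

Variables k p q : nat.

(** The summands are the [k] common vertices and the [p] and [q] vertices proper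
    to each clique. *)
Definition two_cliques_vertex : finType := ('I_k + ('I_p + 'I_q))%type.

Definition opposite_sides (u v : two_cliques_vertex) : bool :=
  match u, v with
  | inr (inl _), inr (inr _) | inr (inr _), inr (inl _) => true
  | _, _ => false
  end.

Definition two_cliques_arc : rel two_cliques_vertex :=
  fun u v => (u != v) && ~~ opposite_sides u v.

Lemma two_cliques_arc_irr : irreflexive two_cliques_arc.
Proof. by move=> u; rewrite /two_cliques_arc eqxx. Qed.

Definition two_cliques : digraph := Digraph two_cliques_arc_irr.

Lemma two_cliques_order : digraph_order two_cliques = k + (p + q).
Proof. by rewrite /digraph_order !card_sum !card_ord. Qed.

Lemma two_cliques_outdeg (u : two_cliques) :
  outdeg u = (match u with
    | inl _ => k + (p + q) | inr (inl _) => k + p | inr (inr _) => k + q end).-1.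
Proof.
have opp : #|[set v | opposite_sides u v]| =
    match u with inl _ => 0 | inr (inl _) => q | inr (inr _) => p end.
  case: u => [x|[x|x]].
  - by apply: eq_card0 => v; rewrite inE.
  - rewrite -[RHS]card_ord -(card_codom (f := fun y : 'I_q => inr (inr y) : two_cliques)).
      by apply: eq_card => -[v|[v|v]]; rewrite inE /=; [symmetry; apply/codomP => -[]..|
        symmetry; apply: codom_f].
    by move=> a b [].
  - rewrite -[RHS]card_ord -(card_codom (f := fun y : 'I_p => inr (inl y) : two_cliques)).
      by apply: eq_card => -[v|[v|v]]; rewrite inE /=; [symmetry; apply/codomP => -[]|
        symmetry; apply: codom_f|symmetry; apply/codomP => -[]].
    by move=> a b [].
have outE : [set v | darc u v] = ~: (u |: [set v | opposite_sides u v]).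
  by apply/setP => v; rewrite !inE negb_or eq_sym.
have self : u \notin [set v | opposite_sides u v] by case: (u) => [x|[x|x]]; rewrite inE.
have := cardsC (u |: [set v | opposite_sides u v]).
rewrite /outdeg outE cardsU1 self opp.
have -> : #|two_cliques| = k + (p + q) := two_cliques_order.
case: u {opp outE self} => [x|[x|x]]; lia.
Qed.

Lemma two_cliques_indeg (u : two_cliques) : indeg u = outdeg u.
Proof.
apply: eq_card => v; rewrite !inE /= /two_cliques_arc eq_sym; congr (_ && ~~ _).
by case: u v => [?|[?|?]] [?|[?|?]].
Qed.

Lemma two_cliques_semidegree :
  0 < p -> p <= q -> min_semidegree two_cliques = (k + p).-1.
Proof.
move=> p_gt0 le_pq; pose u : two_cliques := inr (inl (Ordinal p_gt0)).
apply/eqP; rewrite eqn_leq; apply/andP; split.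
  by have [] := min_semidegree_le u; rewrite two_cliques_outdeg.
apply: (big_ind (fun m => (k + p).-1 <= m)) => [|a b le_a le_b|v _].
  by rewrite two_cliques_order; lia.
  by rewrite leq_min le_a.
rewrite two_cliques_indeg minnn two_cliques_outdeg.
by case: v => [?|[?|?]]; lia.
Qed.

Lemma two_cliques_crossing (x : 'I_p) (y : 'I_q) (r : seq two_cliques) :
  path (@darc two_cliques) (inr (inl x)) r -> inr (inr y) \in r ->
  exists j r1 r2, r = r1 ++ inl j :: r2 /\ inr (inr y) \in r2.
Proof.
elim: r x => // v r IH x /= /andP[xv pr].
case: v xv pr => [j|[x'|y']] // xv pr; rewrite inE /= => yr.
  by exists j, [::], r.
by have [j [r1 [r2 [-> yr2]]]] := IH x' pr yr; exists j, (inr (inl x') :: r1), r2.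
Qed.

(** With the common vertices as sinks, a path from the first side that reaches
    the second one has met a sink before; it would be either its own sink, met
    too early, or the end of another path. *)
Lemma two_cliques_not_coverable :
  0 < p -> 0 < q -> ~ one_to_many_coverable k two_cliques.
Proof.
move=> p_gt0 q_gt0 [_ cov].
pose s : two_cliques := inr (inl (Ordinal p_gt0)).
pose z : two_cliques := inr (inr (Ordinal q_gt0)).
have [||P [Pcov Ppath Pdis]] := cov s (fun i => inl i); try by [].
  by move=> i i' [].
have : z \in [set: two_cliques] by rewrite inE.
rewrite -Pcov => /bigcupP[i _]; rewrite inE.
have [r [PE pr lastr ur]] := Ppath i.
rewrite PE inE /= => zr.
have [j [r1 [r2 [rE zr2]]]] := two_cliques_crossing pr zr.
have jP : inl j \in P i by rewrite PE rE inE mem_cat mem_head !orbT.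
have [ij|ij] := eqVneq i j.
  move: lastr ur; rewrite PE rE last_cat /= -ij => lastr /andP[_].
  rewrite cat_uniq => /and3P[_ _ /andP[/negP nin _]]; apply: nin.
  suff : last (inl i) r2 \in r2 by rewrite lastr.
  by case: (r2) zr2 => //= *; apply: mem_last.
have [r' [PjE _ lastr' _]] := Ppath j.
have jP' : inl j \in P j by rewrite PjE -lastr' mem_last.
by have /setP/(_ (inl j)) := Pdis i j ij; rewrite !inE jP jP'.
Qed.

End TwoCliques.

(** The balanced choice of [p] and [q]. The semidegree rounds [(n + k) / 2] down
    before subtracting one, which is the source of the additive gap for odd
    [n + k]. *)
Lemma sharpness (k n : nat) : k + 2 <= n ->
  exists D : digraph, [/\ digraph_order D = n,
    min_semidegree D = (n + k)./2.-1 & ~ one_to_many_coverable k D].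
Proof.
move=> le_kn; pose p := (n - k)./2; pose q := n - k - p.
have p_gt0 : 0 < p by rewrite /p; lia.
have le_pq : p <= q by rewrite /q /p; lia.
exists (two_cliques k p q); split.
- by rewrite two_cliques_order /q /p; lia.
- by rewrite two_cliques_semidegree // /p; lia.
- by apply: two_cliques_not_coverable => //; apply: leq_trans le_pq.
Qed.

Theorem theorem7 (k : nat) (hk : 2 <= k) :
  (forall D : digraph,
     3 * k <= digraph_order D ->
     uphalf (digraph_order D + k) <= min_semidegree D ->
     one_to_many_coverable k D)
  /\
  (forall n : nat, 3 * k <= n ->
     (~~ odd (n + k) ->
        exists D : digraph,
          [/\ digraph_order D = n,
              min_semidegree D = uphalf (n + k) - 1
            & ~ one_to_many_coverable k D])
     /\
     (odd (n + k) ->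
        exists D : digraph,
          [/\ digraph_order D = n,
              min_semidegree D = uphalf (n + k) - 2
            & ~ one_to_many_coverable k D])).
Proof.
split=> [D le_kn|n le_kn].
  rewrite leq_uphalf_double => le_h.
  by apply: coverable_of_semidegree => //; lia.
have [|D [orderD semiD ncov]] := @sharpness k n; first lia.
split=> parity; exists D; split=> //; rewrite semiD uphalf_half.
  by rewrite (negPf parity); lia.
by rewrite parity; lia.
Qed.
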